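(* Let $k, c, n$ be positive integers such that $c \geq n+k+1$, $n \geq k+1$, and $c+1 \leq n \cdot k$. Let $G := \Omega_5 K_{c+1}$ and let $H := K_c^{G}$ be the exponential graph. Then $\chi(G) > c$ and $\chi(H) > c$, yet $\chi(G \times H) \leq c$.
   Context: $\chi$ denotes the chromatic number, $K_m$ the complete graph on $m$ vertices, and $[c] = \{1,\dots,c\}$. The graph $\Omega_5 K_m$ is defined as follows. Its vertices are the tuples $(x_1,\dots,x_m) \in \{0,1,2,3\}^m$ such that there is exactly one $i \in [m]$ with $x_i = 0$ and there is some $i \in [m]$ with $x_i = 1$. Two vertices $(x_1,\dots,x_m)$ and $(y_1,\dots,y_m)$ are adjacent if and only if for every $i \in [m]$ either $|x_i - y_i| = 1$ or $x_i = y_i = 3$. For a graph $G$, the exponential graph $K_c^G$ has as vertices all functions $V(G) \to [c]$; two such functions $f, g$ are adjacent if and only if $f(v) \neq g(v')$ for all ordered pairs $(v,v')$ of adjacent vertices of $G$. (A function $f$ may satisfy this condition with itself, in which case it carries a loop; a graph with a loop has no proper coloring and its chromatic number is taken to be $\infty$.) The tensor product $G \times H$ is the graph with vertex set $V(G) \times V(H)$ in which $(g,h)$ and $(g',h')$ are adjacent if and only if $gg' \in E(G)$ and $hh' \in E(H)$. *)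

(* Defs.v *)
From HB Require Import structures.
From mathcomp Require Import all_boot all_order all_algebra.

Set Implicit Arguments.
Unset Strict Implicit.
Unset Printing Implicit Defensive.

Import IntDist.

(* Finite undirected graphs; loops are allowed because exponential graphs may
   have them. *)
Record graph := Graph {
  vertex :> finType;
  adj : rel vertex;
  adj_sym : symmetric adj }.

Definition loopless (G : graph) : bool := [forall v : G, ~~ adj v v].

Definition proper_coloring (G : graph) k (f : {ffun G -> 'I_k}) : bool :=
  [forall u : G, forall v : G, adj u v ==> (f u != f v)].

Definition colorable (G : graph) (k : nat) : bool :=
  [exists f : {ffun G -> 'I_k}, proper_coloring f].

Lemma loopless_colorable (G : graph) :
  loopless G -> exists k, colorable G k.
Proof.
move=> /forallP loopG; exists #|G|.
apply/existsP; exists [ffun v => enum_rank v].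
apply/forallP => u; apply/forallP => v; apply/implyP => uv.
rewrite !ffunE (inj_eq enum_rank_inj).
by apply: contraTneq uv => ->.
Qed.

(* Natural numbers extended with infinity, [None] being infinity. *)
Definition natinf := option nat.

Definition natinf_le (a b : natinf) : bool :=
  match a, b with
  | _, None => true
  | None, Some _ => false
  | Some i, Some j => i <= j
  end.

Definition natinf_lt (a b : natinf) : bool := ~~ natinf_le b a.

Definition chi (G : graph) : natinf :=
  if @idP (loopless G) is ReflectT h then Some (ex_minn (loopless_colorable h))
  else None.

Section Tensor.
Variables G H : graph.

Definition tensor_adj : rel (G * H)%type :=
  fun p q => adj p.1 q.1 && adj p.2 q.2.

Fact tensor_adj_sym : symmetric tensor_adj.
Proof. by move=> p q; rewrite /tensor_adj adj_sym (adj_sym p.2). Qed.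

Definition tensor : graph := Graph tensor_adj_sym.

End Tensor.

Section Exponential.
Variables (c : nat) (G : graph).

Definition exp_adj : rel {ffun G -> 'I_c} :=
  fun f g => [forall v : G, forall v' : G, adj v v' ==> (f v != g v')].

Fact exp_adj_sym : symmetric exp_adj.
Proof.
suff sub f g : exp_adj f g -> exp_adj g f by move=> f g; apply/idP/idP; exact: sub.
move=> /forallP fg; apply/forallP => v; apply/forallP => v'; apply/implyP => vv'.
have /forallP/(_ v)/implyP := fg v'.
by rewrite eq_sym; apply; rewrite adj_sym.
Qed.

Definition exp_graph : graph := Graph exp_adj_sym.

End Exponential.

Section Omega5.
Variable m : nat.

Definition omega5_vertex (x : {ffun 'I_m -> 'I_4}) : bool :=
  (#|[set i | x i == 0 :> nat]| == 1) && [exists i, x i == 1 :> nat].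

Definition omega5_adj : rel {x : {ffun 'I_m -> 'I_4} | omega5_vertex x} :=
  fun x y => [forall i, (`|val x i - val y i|%N == 1)
                        || ((val x i == 3 :> nat) && (val y i == 3 :> nat))].

Fact omega5_adj_sym : symmetric omega5_adj.
Proof. by move=> x y; apply: eq_forallb => i; rewrite distnC andbC. Qed.

Definition omega5K : graph := Graph omega5_adj_sym.

End Omega5.

(* Main.v *)
Require Import Defs.
From mathcomp Require Import all_boot all_order all_algebra.
From mathcomp Require Import zify.

(** Write G for Omega_5 K_m with m = c + 1 and H for K_c^G.

    The product G x H is c-coloured by evaluation, (v, f) |-> f v: this is what
    adjacency in an exponential graph says ([tensor_exp_colorable]).

    The bound chi(G) > c ([omega5_not_colorable]) is the topological part: the
    box complex of G is, up to homotopy, the sphere of dimension m - 2, and Ky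
    Fan's lemma then yields m colours.  The argument here is finite.  Chains are
    taken modulo 2 in the complex whose simplices are lists of signed vertices
    of G in which vertices of opposite signs are adjacent.  Such a list is
    alternating for a colouring when its colours are distinct and the signs
    alternate as the colours increase; it is positive when the largest colour has
    the positive sign.  If w is a chain and z its boundary, then
    z has as many positive alternating simplices, modulo 2, as w has
    alternating simplices of both kinds ([fan_cobdry]).  Hence, if z is a cycle
    that is invariant under the sign change nu and has an odd number of positive
    alternating simplices, and if w fills z, then w + nu w is again such a cycle,
    one dimension higher ([fan_cycle_suspension]).  A cycle supported on the
    vertices whose coordinates from d on are 3 can be filled on those whose
    coordinates from d + 1 on are 3 ([cycle_filling]): seven elementary
    homotopies move coordinate d along 3, 2, 1, 0, 1, 0, 1, 0 and bring all
    positive vertices to one point, from which the result is coned off.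
    Iterating, one reaches an alternating simplex with m vertices, so the
    colouring uses at least m colours.

    The bound chi(H) > c ([exp_omega5_not_colorable]) is by contradiction.  After
    renaming colours, a colouring psi of H gives the constant map a the colour a,
    so that psi f is always a value of f ([suited_coloring]).  Split the m
    coordinates into n classes of size at most k, and let f v be the class of the
    coordinate where v is 0.  Put b := psi f.  Choose distinct colours
    kappa i, all outside the first n, for the coordinates i of class b.  Let g be kappa i near
    coordinate i (where v i = 1), for i in the class b, and b elsewhere.  Then g
    is adjacent to f, so psi g = kappa i for some i.  Let s be one of the
    first n colours, different from b, and let h_(i,t) be t where v i is odd and s where v i
    is even.  With t = kappa i this is adjacent to g, so psi (h_(i,t)) = s.  But
    h_(i,t) and h_(i,t') are adjacent for distinct t, t', so every i comes with at
    most one such t.  Now let kappa run through k + 1 cyclic shifts: as the class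
    has at most k elements, some i occurs for two shifts, with two different t. *)

Set Implicit Arguments.
Unset Strict Implicit.
Unset Printing Implicit Defensive.

Import IntDist.

(** * The chromatic number and exponential graphs *)

Lemma chi_le (G : graph) c : colorable G c -> natinf_le (chi G) (Some c).
Proof.
move=> colG; rewrite /chi; case: {-}_ / idP => [loopG|] /=.
  by case: ex_minnP => k _; apply.
case; apply/forallP => v; apply/negP => vv.
case/existsP: colG => f /forallP/(_ v)/forallP/(_ v)/implyP/(_ vv).
by rewrite eqxx.
Qed.

Lemma chi_gt (G : graph) c : ~~ colorable G c -> natinf_lt (Some c) (chi G).
Proof.
rewrite /natinf_lt /chi; case: {-}_ / idP => [loopG|] //=.
case: ex_minnP => k /existsP[f /forallP colf] _; apply: contra => le_kc.
apply/existsP; exists [ffun v => widen_ord le_kc (f v)].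
apply/forallP => u; apply/forallP => v; apply/implyP => uv; rewrite !ffunE.
by have /forallP/(_ v)/implyP/(_ uv) := colf u.
Qed.

Lemma tensor_exp_colorable (G : graph) c :
  colorable (tensor G (exp_graph c G)) c.
Proof.
apply/existsP; exists [ffun p : tensor G (exp_graph c G) => (p.2 : {ffun G -> 'I_c}) p.1].
apply/forallP => p; apply/forallP => q; apply/implyP => /andP[pq1 /forallP pq2].
by rewrite !ffunE; have /forallP/(_ q.1)/implyP/(_ pq1) := pq2 p.1.
Qed.

(** The constant maps form a c-clique, so the colours can be renamed to make the
    constant map a receive the colour a; a map that avoids the value a is adjacent
    to that constant map, hence does not receive the colour a. *)
Lemma suited_coloring (G : graph) c :
  colorable (exp_graph c G) c ->
  exists psi : {ffun G -> 'I_c} -> 'I_c,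
    (forall f g : {ffun G -> 'I_c}, exp_adj f g -> psi f != psi g) /\
    (forall f : {ffun G -> 'I_c}, exists v, f v = psi f).
Proof.
case/existsP => Psi /forallP colPsi.
have Psi_neq f g : exp_adj f g -> Psi f != Psi g.
  by have /forallP/(_ g)/implyP := colPsi f.
pose sigma a := Psi [ffun=> a].
have sigma_inj : injective sigma.
  move=> a b sab; apply/eqP; apply: contra_eqT (sab) => ab.
  apply: Psi_neq; apply/forallP => v; apply/forallP => w.
  by rewrite !ffunE ab implybT.
exists (fun f => invF sigma_inj (Psi f)); split=> [f g /Psi_neq|f].
  by apply: contra => /eqP/(can_inj (f_invF sigma_inj))/eqP.
set a := invF _ _; case: (pickP (fun v => f v == a)) => [v /eqP|noa].
  by exists v.
have: sigma a != Psi f.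
  apply: Psi_neq; apply/forallP => v; apply/forallP => w.
  by rewrite ffunE eq_sym noa implybT.
by rewrite f_invF eqxx.
Qed.

(** * Exponential graphs of Omega_5 K_m *)

Lemma omega5_adjP m (u v : omega5K m) i : adj u v ->
  `|val u i - val v i|%N == 1 \/ (val u i = 3 :> nat) /\ (val v i = 3 :> nat).
Proof. by move=> /forallP/(_ i)/orP[|/andP[/eqP ? /eqP ?]]; [left|right]. Qed.

Lemma omega5_zero m (v : omega5K m) : exists i, val v i == 0 :> nat.
Proof.
have /andP[/cards1P[i zi] _] := valP v.
by exists i; have := set11 i; rewrite -zi inE.
Qed.

(** Of the c colours, the first n serve as names for the classes i %/ k of
    coordinates and the next k + 1 as the values of kappa. *)
Lemma exp_omega5_not_colorable (m n k c : nat) :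
    0 < k -> 1 < n -> n + k + 1 <= c -> m <= n * k ->
  ~~ colorable (exp_graph c (omega5K m)) c.
Proof.
move=> k_gt0 n_gt1 le_nk_c le_m_nk; apply/negP => /suited_coloring[psi [psiP psi_im]].
have c_gt0 : 0 < c by lia.
pose col j : 'I_c := insubd (Ordinal c_gt0) j.
have colE j : j < c -> col j = j :> nat by move=> ltjc; rewrite insubdK.
have col_neq i j : i < c -> j < c -> i <> j -> col i <> col j.
  by move=> ic jc ij /(congr1 val) /=; rewrite !colE.
pose zero (v : omega5K m) := xchoose (omega5_zero v).
have zeroP (v : omega5K m) : val v (zero v) = 0 :> nat by exact/eqP/(xchooseP (omega5_zero v)).
have divk_n (i : 'I_m) : i %/ k < n by rewrite ltn_divLR //; have := ltn_ord i; lia.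
pose f := [ffun v => col (zero v %/ k)].
have [b b_n fb] : exists2 b, b < n & psi f = col b.
  by have [v <-] := psi_im f; exists (zero v %/ k); rewrite ?ffunE.
(* Injective in i within a class, and in a <= k. *)
pose kappa a i := n + (i %% k + a) %% k.+1.
have kappa_c a i : kappa a i < c.
  by rewrite /kappa; have := ltn_pmod (i %% k + a) (ltn0Sn k); lia.
have kappa_n a i : n <= kappa a i by rewrite /kappa; lia.
pose g a : {ffun omega5K m -> 'I_c} := [ffun v : omega5K m =>
  if [pick i : 'I_m | (i %/ k == b) && (val v i == 1 :> nat)] is Some i
  then col (kappa a i) else col b].
have adj_fg a : exp_adj f (g a).
  apply/forallP => v; apply/forallP => w; apply/implyP => vw; rewrite !ffunE.
  case: pickP => [i _|noi]; apply/eqP; apply: col_neq => //.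
  - by have := divk_n (zero v); lia.
  - by have := divk_n (zero v); have := kappa_n a i; lia.
  - by have := divk_n (zero v); lia.
  - by lia.
  move=> zb; have := noi (zero v); rewrite zb eqxx /=.
  have := omega5_adjP (zero v) vw; rewrite zeroP => -[|[//]].
  by rewrite dist0n => ->.
pose s := if b == 0 then 1 else 0.
have [s_n s_b] : s < n /\ s <> b by rewrite /s; case: eqP => ?; lia.
pose h (i : 'I_m) t : {ffun omega5K m -> 'I_c} := [ffun v : omega5K m => if odd (val v i) then col t else col s].
have good a : exists i : 'I_m, (i %/ k == b) && (psi (h i (kappa a i)) == col s).
  have [i [/eqP ib psi_g]] : exists i : 'I_m, i %/ k == b /\ psi (g a) = col (kappa a i).
    have := psiP _ _ (adj_fg a); have [v <-] := psi_im (g a).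
    rewrite fb ffunE; case: pickP => [i /andP[ib _] _|]; last by rewrite eqxx.
    by exists i.
  exists i; rewrite ib eqxx /=.
  (* The colour kappa a i identifies i within the class b. *)
  have g_near w : g a w = col (kappa a i) -> val w i = 1 :> nat.
    rewrite ffunE; case: pickP => [j /andP[/eqP jb /eqP wj] eq_col|_ eq_col].
      suff <- : j = i by [].
      apply/val_inj; rewrite /= (divn_eq j k) (divn_eq i k) jb ib; congr (_ + _).
      have [//|neq_ij] := eqVneq (j %% k) (i %% k).
      case: (col_neq _ _ (kappa_c a j) (kappa_c a i) _ eq_col).
      rewrite /kappa => /addnI/eqP; rewrite eqn_modDr => /eqP.
      have := ltn_pmod j k_gt0; have := ltn_pmod i k_gt0 => ? ?.
      by rewrite !(@modn_small _ k.+1) ?ltnS; lia.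
    by case: (col_neq _ _ _ (kappa_c a i) _ eq_col); have := kappa_n a i; lia.
  have := psiP (g a) (h i (kappa a i)); have [v <-] := psi_im (h i (kappa a i)).
  rewrite psi_g [h _ _ v]ffunE; case: ifP => // _ neq_g.
  rewrite eqxx in neq_g; suff /neq_g : exp_adj (g a) (h i (kappa a i)) by [].
  apply/forallP => x; apply/forallP => y; apply/implyP => xy; apply/eqP.
  rewrite [h _ _ y]ffunE; case: ifP => [oy /g_near xi|_].
    by have [] := omega5_adjP i xy; rewrite xi; lia.
  rewrite ffunE; case: pickP => [j _|_]; apply: col_neq => //; try lia.
  by have := kappa_n a j; lia.
(* k + 1 shifts a, and at most k coordinates in the class b, told apart by their
   residues. *)
pose r (a : 'I_k.+1) : 'I_k := Ordinal (ltn_pmod (xchoose (good a)) k_gt0).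
have /injectivePn[a [a' aa' rr]] : ~~ injectiveb r.
  by apply/negP => /injectiveP/leq_card; rewrite !card_ord ltnn.
move/(congr1 val): rr => /=; have := xchooseP (good a); have := xchooseP (good a').
set i := xchoose _; set i' := xchoose _ => /andP[/eqP ib pi] /andP[/eqP ib' pi'] ii'.
have {ii' ib} eq_i : i = i'.
  by apply: val_inj; rewrite /= (divn_eq i k) (divn_eq i' k) ib ib' ii'.
rewrite {}eq_i in pi; have /negP[] : psi (h i' (kappa a i')) != psi (h i' (kappa a' i')).
  apply: psiP; apply/forallP => v; apply/forallP => w; apply/implyP => vw.
  rewrite !ffunE; case: ifP => ov; case: ifP => ow; apply/eqP.
  - apply: col_neq => //; move: aa'; rewrite -val_eqE /= /kappa => /eqP aa' /addnI/eqP.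
    rewrite eqn_modDl => /eqP; have := ltn_ord a; have := ltn_ord a' => ? ?.
    by rewrite !modn_small; lia.
  - by apply: col_neq => //; have := kappa_n a i'; lia.
  - by apply: col_neq => //; have := kappa_n a' i'; lia.
  (* Both values are s: the two coordinates are even, hence not adjacent. *)
  by have [] := omega5_adjP i' vw; lia.
by rewrite (eqP pi) (eqP pi').
Qed.

(** * Chains modulo 2 of lists *)

Section Chains.
Implicit Types T U : Type.

(** A chain modulo 2 is a list of simplices, each a list of vertices in which
    repetitions are allowed.  Chains are compared only through their values on
    arbitrary cochains F. *)
Definition pairing T (F : seq T -> bool) (z : seq (seq T)) : bool :=
  \big[addb/false]_(s <- z) F s.

Fixpoint faces T (s : seq T) : seq (seq T) :=
  if s is x :: s' then s' :: map (cons x) (faces s') else [::].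

(** The boundary of a chain z is expressed dually: [pairing (cobdry F) z] is the
    value of F on it.  The faces of a vertex include the empty list, so the
    homology in question is reduced. *)
Definition cobdry T (F : seq T -> bool) (s : seq T) : bool := pairing F (faces s).

(** The simplices f x_0, ..., f x_i, g x_i, ..., g x_d. *)
Fixpoint prism T U (f g : T -> U) (s : seq T) : seq (seq U) :=
  if s is x :: s' then
    (f x :: g x :: map g s') :: map (cons (f x)) (prism f g s')
  else [::].

Lemma pairing_cat T F (z1 z2 : seq (seq T)) :
  pairing F (z1 ++ z2) = pairing F z1 (+) pairing F z2.
Proof. exact: big_cat. Qed.

Lemma pairing_map T U (h : seq T -> seq U) F z :
  pairing F (map h z) = pairing (F \o h) z.
Proof. exact: big_map. Qed.

Lemma pairing_flatten T U (P : seq T -> seq (seq U)) F z :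
  pairing F (flatten (map P z)) = pairing (fun s => pairing F (P s)) z.
Proof. by rewrite /pairing big_flatten big_map. Qed.

Lemma pairing_addb T F1 F2 (z : seq (seq T)) :
  pairing (fun s => F1 s (+) F2 s) z = pairing F1 z (+) pairing F2 z.
Proof. exact: big_split. Qed.

Lemma cobdry_cons T F x (s : seq T) :
  cobdry F (x :: s) = F s (+) cobdry (F \o cons x) s.
Proof. by rewrite /cobdry /pairing /= big_cons big_map. Qed.

Lemma faces_map T U (h : T -> U) s : faces (map h s) = map (map h) (faces s).
Proof.
elim: s => //= x s ->; congr (_ :: _).
by rewrite -!map_comp; apply: eq_map.
Qed.

Lemma cobdry_map T U (h : T -> U) F s :
  cobdry F (map h s) = cobdry (F \o map h) s.
Proof. by rewrite /cobdry faces_map pairing_map. Qed.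

(** The boundary of a prism consists of the prism over the boundary, the bottom
    and the top. *)
Lemma prism_cobdry T U (f g : T -> U) F s :
  pairing (cobdry F) (prism f g s) =
  cobdry (fun t => pairing F (prism f g t)) s (+) (F (map f s) (+) F (map g s)).
Proof.
elim: s F => [|x s IHs] F /=; first by rewrite /cobdry /pairing !big_nil addbb.
rewrite /pairing big_cons big_map -/(pairing _ _) /=.
under [X in _ (+) X = _]eq_bigr do rewrite cobdry_cons.
rewrite big_split /= -!/(pairing _ _) IHs !cobdry_cons cobdry_map /=.
have -> : cobdry ((fun t => pairing F (prism f g t)) \o cons x) s =
    cobdry (F \o cons (f x) \o cons (g x) \o map g) s (+)
    cobdry (fun t => pairing (F \o cons (f x)) (prism f g t)) s.
  rewrite /cobdry -pairing_addb; apply: eq_bigr => t _ /=.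
  by rewrite /pairing big_cons big_map.
rewrite -/(pairing F _); move: (cobdry _ s) (cobdry _ s) (pairing _ _) (F _) (F _) (F _).
by do 6!case.
Qed.

(** A face omits an element either of the part satisfying P or of the other
    part. *)
Lemma cobdry_partition T (P : pred T) (K : seq T -> seq T -> bool) s :
  let p := filter P s in let r := filter (predC P) s in
  cobdry (fun u => K (filter P u) (filter (predC P) u)) s =
  cobdry (K^~ r) p (+) cobdry (K p) r.
Proof.
elim: s K => [|x s IHs] K /=; first by rewrite /cobdry /pairing !big_nil.
rewrite cobdry_cons; case: (boolP (P x)) => Px /=; rewrite !cobdry_cons.
  rewrite /cobdry /comp /= Px /= -!/(cobdry _ _).
  by rewrite (IHs (fun u => K (x :: u))) addbA.
rewrite /cobdry /comp /= (negPf Px) /= -!/(cobdry _ _).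
by rewrite (IHs (fun u v => K u (x :: v))) addbCA.
Qed.

End Chains.

Lemma mem_prism (T U : eqType) (f g : T -> U) s u :
  u \in prism f g s ->
  size u = (size s).+1 /\ {subset u <= map f s ++ map g s}.
Proof.
elim: s u => [|x s IHs] u //=; rewrite inE => /predU1P[->|/mapP[u' /IHs[szu' sub] ->]].
  split=> [|y]; first by rewrite /= size_map.
  by rewrite !(inE, mem_cat) => /or3P[->|->|->]; rewrite ?orbT.
split=> [|y]; first by rewrite /= szu'.
rewrite !(inE, mem_cat) => /predU1P[->|/sub]; first by rewrite eqxx.
by rewrite mem_cat => /orP[->|->]; rewrite ?orbT.
Qed.

(** * Alternating lists and the parity identity of Ky Fan *)

(** Elements are pairs of a colour and a sign.  The colours in s are to be less
    than c and distinct, with signs that alternate in the order of the colours;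
    the recursion goes down from the largest colour, whose sign is [top].  The
    order of the list s does not matter. *)
Fixpoint alternating c (top : bool) (s : seq (nat * bool)) : bool :=
  if c is c'.+1 then
    let r := [seq e <- s | e.1 != c'] in
    match [seq e <- s | e.1 == c'] with
    | [::] => alternating c' top r
    | [:: e] => (e.2 == top) && alternating c' (~~ top) r
    | _ => false
    end
  else nilp s.

Definition flip T (p : T * bool) := (p.1, ~~ p.2).

Lemma alternating_nil c top : alternating c top [::].
Proof. by elim: c => //= c ->. Qed.

Lemma alternating_size c top s : alternating c top s -> size s <= c.
Proof.
elim: c top s => [|c IHc] top s /=; first by rewrite leqn0.
rewrite -(count_predC (fun e => e.1 == c) s) -!size_filter.
have -> : filter (predC (fun e => e.1 == c)) s = [seq e <- s | e.1 != c] by [].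
case: [seq e <- s | e.1 == c] => [/IHc|e [/andP[_ /IHc]|//]] /=; lia.
Qed.

Lemma alternating_flip c top s :
  alternating c top (map (@flip nat) s) = alternating c (~~ top) s.
Proof.
elim: c top s => [|c IHc] top s /=; first by case: s.
rewrite !filter_map /= /preim /=.
case: [seq e <- s | e.1 == c] => [|e []] //=; rewrite IHc //.
by case: e.2 top => -[].
Qed.

(** An alternating list has exactly one face that is alternating with a given top
    sign, obtained by omitting the element of largest or of smallest colour.  Any
    other list without opposite elements of equal colour has an even number of
    such faces: when it has one, exactly two elements can be omitted, equal or of
    consecutive colours.  The induction on c separates the elements of the
    largest colour from the others. *)
Lemma alternating_cobdry c top (s : seq (nat * bool)) :
    all (fun e => e.1 < c) s ->
    {in s &, forall e e', e.1 = e'.1 -> e.2 = e'.2} ->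
  cobdry (alternating c top) s = alternating c true s (+) alternating c false s.
Proof.
elim: c top s => [|c IHc] top s; first by case: s => //= _ _; rewrite /cobdry /pairing big_nil.
move=> lt_c coh.
pose K t (p r : seq (nat * bool)) := match p with
    | [::] => alternating c t r
    | [:: e] => (e.2 == t) && alternating c (~~ t) r
    | _ => false end.
have altE t u : alternating c.+1 t u = K t [seq e <- u | e.1 == c] [seq e <- u | e.1 != c] by [].
rewrite /cobdry; have -> : pairing (alternating c.+1 top) (faces s) =
   pairing (fun u => K top [seq e <- u | e.1 == c] [seq e <- u | e.1 != c]) (faces s).
  by apply: eq_bigr => u _; exact: altE.
rewrite -/(cobdry _ _) (cobdry_partition (fun e => e.1 == c) (K top)).
rewrite !altE (_ : filter (predC _) s = [seq e <- s | e.1 != c]) //.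
set p := [seq e <- s | e.1 == c]; set r := [seq e <- s | e.1 != c].
have {}IHc t : cobdry (alternating c t) r = alternating c true r (+) alternating c false r.
  apply: IHc => [|e e']; last by rewrite !mem_filter => /andP[_ ?] /andP[_]; exact: coh.
  by apply/allP => e; rewrite mem_filter => /andP[ec /(allP lt_c)]; rewrite /= ltnS (leq_eqVlt e.1) (negPf ec).
have cohp : {in p &, forall e e', e.2 = e'.2}.
  move=> e1 e2; rewrite !mem_filter => /andP[/eqP ec es] /andP[/eqP e'c e's].
  by apply: coh; rewrite ?ec ?e'c.
have cob_nil T (F : seq T -> bool) : cobdry F [::] = false.
  by rewrite /cobdry /pairing big_nil.
have cob0 T (t : seq T) : cobdry (fun=> false) t = false.
  by rewrite /cobdry /pairing big1.
(* No, one, or at least two elements of the largest colour. *)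
case: p cohp => [|e [|e' q]] cohp.
- by rewrite cob_nil /= IHc.
- rewrite cobdry_cons cob_nil addbF.
  have -> : cobdry (K top [:: e]) r =
      (e.2 == top) && cobdry (alternating c (~~ top)) r.
    by rewrite /cobdry /pairing big_distrr.
  rewrite /= IHc; case: e.2 top => -[] /=;
    by case: (alternating c true r) (alternating c false r) => -[].
rewrite [X in _ (+) X]cob0 addbF !cobdry_cons /=.
have -> : e.2 = e'.2 by apply: cohp; rewrite !inE eqxx ?orbT.
case: q {cohp} => [|e'' q]; first by rewrite cob_nil addbF addbb.
by rewrite /cobdry /pairing big1 // => u _; case: u.
Qed.

(** * The levels of the homotopy *)

Definition near (p q : nat) : bool := (`|p - q|%N == 1) || ((p == 3) && (q == 3)).

Lemma nearC p q : near p q = near q p.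
Proof. by rewrite /near distnC andbC. Qed.

(** At level l, a vertex whose coordinates from d on are 3 is changed by applying
    [symbol_map l] to its first d coordinates and setting coordinate d to
    [last_symbol l].  Consecutive rows of the table preserve adjacency of symbols.
    In each row exactly one coordinate of the result is 0: coordinate d if
    [last_symbol l] is 0, and otherwise the one that was 0 before.  Row 7 does not
    depend on the vertex, and its symbols are adjacent to all those of row 6. *)
Definition last_symbol l : nat := nth 0 [:: 3; 2; 1; 0; 1; 0; 1; 0] l.
Definition symbol_map l p : nat :=
  nth 0 (nth [::] [:: [:: 0; 1; 2; 3]; [:: 0; 1; 2; 3]; [:: 0; 1; 2; 3];
                      [:: 2; 1; 2; 3]; [:: 0; 3; 2; 3]; [:: 3; 1; 3; 3];
                      [:: 0; 2; 2; 2]; [:: 1; 1; 1; 1]] l) p.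

(** Properties of the table are verified by evaluation on all entries. *)
Lemma table_check (P : nat -> nat -> nat -> bool) :
    all (fun l => all (fun p => all (P l p) (iota 0 4)) (iota 0 4)) (iota 0 8) ->
  forall l (p q : 'I_4), l < 8 -> P l p q.
Proof.
move=> ok l p q l8; have mem4 (r : 'I_4) : (r : nat) \in iota 0 4.
  by rewrite mem_iota /=.
have l_iota : l \in iota 0 8 by rewrite mem_iota.
exact: allP (allP (allP ok l l_iota) p (mem4 p)) q (mem4 q).
Qed.

Lemma last_symbol_lt l : last_symbol l < 4.
Proof. by do 8?[case: l => [|l] //]; rewrite /last_symbol nth_default. Qed.

Lemma symbol_map_lt l (p : 'I_4) : symbol_map l p < 4.
Proof.
case: (ltnP l 8) => [l8|l8].
  exact: (@table_check (fun l p _ => symbol_map l p < 4) isT l p p l8).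
by rewrite /symbol_map (@nth_default _ [::]) ?nth_nil.
Qed.

Lemma near_last_symbol l : l < 7 -> near (last_symbol l) (last_symbol l.+1).
Proof. by do 7?[case: l => [|l] //]. Qed.

Lemma near_symbol_map l (p q : 'I_4) :
  l < 7 -> near p q -> near (symbol_map l p) (symbol_map l.+1 q).
Proof.
move=> l7; apply/implyP; move: (l7); apply/implyP.
exact: (@table_check (fun l p q => (l < 7) ==> (near p q ==>
  near (symbol_map l p) (symbol_map l.+1 q))) isT l p q (ltnW l7)).
Qed.

Lemma near_apex (p q : 'I_4) : near (symbol_map 7 p) (symbol_map 6 q).
Proof.
exact: (@table_check (fun _ p q => near (symbol_map 7 p) (symbol_map 6 q))
  isT 0 p q isT).
Qed.

Lemma symbol_map_id (p : 'I_4) : symbol_map 0 p = p.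
Proof.
apply/eqP.
exact: (@table_check (fun _ p _ => symbol_map 0 p == p) isT 0 p p isT).
Qed.

Lemma symbol_map_zero l (p : 'I_4) : l < 8 ->
  (symbol_map l p == 0) = (last_symbol l != 0) && (p == 0 :> nat).
Proof.
move=> l8; apply: (elimT eqP).
exact: (@table_check (fun l p _ =>
  (symbol_map l p == 0) == ((last_symbol l != 0) && (p == 0))) isT l p p l8).
Qed.

Lemma symbol_map_one l : l < 8 -> (last_symbol l == 1) || (symbol_map l 1 == 1).
Proof. by do 8?[case: l => [|l] //]. Qed.

(** * Simplices of signed vertices *)

Section Levels.
Variable m : nat.
Local Notation vec := {ffun 'I_m -> 'I_4}.
Implicit Types (x y : vec) (p q : vec * bool) (s : seq (vec * bool)).

Definition vec_adj x y := [forall i, near (x i) (y i)].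

Lemma vec_adjC x y : vec_adj x y = vec_adj y x.
Proof. by apply: eq_forallb => i; rewrite nearC. Qed.

(** The vertices of Omega_5 K_m whose coordinates from d on are 3; for d <= m they
    form a copy of Omega_5 K_d. *)
Definition below d x :=
  omega5_vertex x && [forall i : 'I_m, (d <= i) ==> (x i == 3 :> nat)].

(** Vertices of opposite signs have to be adjacent; equal signs impose nothing. *)
Definition compat p q := (p.2 == q.2) || vec_adj p.1 q.1.

Lemma compatC p q : compat p q = compat q p.
Proof. by rewrite /compat eq_sym vec_adjC. Qed.

Definition simplex d e s :=
  [&& size s == e, all (fun p => below d p.1) s & all2rel compat s].

Definition level d l x : vec :=
  [ffun i : 'I_m => if i < d then inord (symbol_map l (x i))
           else if i == d :> nat then inord (last_symbol l) else inord 3].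

Lemma levelE d l x i : level d l x i =
  (if i < d then symbol_map l (x i) else if i == d :> nat then last_symbol l else 3)
  :> nat.
Proof.
rewrite ffunE; case: ifP => _; first by rewrite inordK ?symbol_map_lt.
by case: ifP => _; rewrite inordK ?last_symbol_lt.
Qed.

Lemma level0 d x : below d x -> level d 0 x = x.
Proof.
case/andP => _ /forallP x3; apply/ffunP => i; apply/val_inj; rewrite /= levelE symbol_map_id.
have := x3 i; case: ltnP => //= _ /eqP->; by case: eqP.
Qed.

Lemma level_adj d l x y :
  l < 7 -> vec_adj x y -> vec_adj (level d l x) (level d l.+1 y).
Proof.
move=> l7 /forallP xy; apply/forallP => i; rewrite !levelE; case: ifP => _.
  exact: near_symbol_map.
by case: ifP => // _; exact: near_last_symbol.
Qed.

Lemma level0_adj d x y : vec_adj x y -> vec_adj (level d 0 x) (level d 0 y).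
Proof.
move=> /forallP xy; apply/forallP => i; rewrite !levelE !symbol_map_id.
by case: ifP => // _; case: ifP.
Qed.

Lemma apex_adj d x y : vec_adj (level d 7 x) (level d 6 y).
Proof.
apply/forallP => i; rewrite !levelE; case: ifP => _; first exact: near_apex.
by case: ifP.
Qed.

Lemma level_below d l x :
  d < m -> l < 8 -> below d x -> below d.+1 (level d l x).
Proof.
move=> dm l8 /andP[/andP[x0 /existsP[j xj]] /forallP x3].
apply/andP; split; last first.
  apply/forallP => i; apply/implyP => di; rewrite levelE ltnNge (ltnW di) /=.
  by rewrite (gtn_eqF di).
apply/andP; split.
  case: (eqVneq (last_symbol l) 0) => ll.
    apply/cards1P; exists (Ordinal dm); apply/setP => i; rewrite !inE levelE -val_eqE /=.
    by case: (ltngtP i d) => //= _; rewrite ?ll // symbol_map_zero ?ll.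
  rewrite (_ : [set i | _] = [set i | x i == 0 :> nat]) //.
  apply/setP => i; rewrite !inE levelE; have := x3 i.
  case: (ltngtP i d) => /= [_ _|_ /eqP-> //|_ /eqP->]; last by rewrite (negPf ll).
  by rewrite symbol_map_zero // ll.
apply/existsP; have /orP[ll|ll] := symbol_map_one l8.
  by exists (Ordinal dm); rewrite levelE /= ltnn eqxx.
exists j; rewrite levelE (eqP xj); have := x3 j.
by rewrite (eqP xj); case: ltnP.
Qed.

(** A level can only be compared with the next one, so vertices of the two signs
    have to sit on neighbouring levels.  Stages move them in turn: positive
    vertices run through the levels 0, 1, 1, 3, 3, 5, 5, 7 and negative ones
    through 0, 0, 2, 2, 4, 4, 6, 6. *)
Definition stage_level (b : bool) j := if b then (uphalf j).*2.-1 else j./2.*2.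
Arguments stage_level : simpl never.
Definition stage d j p := (level d (stage_level p.2 j) p.1, p.2).

Lemma stage_level_lt b j : j < 8 -> stage_level b j < 8.
Proof. by case: b; do 8?[case: j => [|j] //]. Qed.

(** Across stages j and j + 1 the levels of the two signs always differ by one,
    except at the start, where both may be 0. *)
Lemma stage_levels j i i' : j < 7 -> i \in [:: j; j.+1] -> i' \in [:: j; j.+1] ->
  let l := stage_level true i in let l' := stage_level false i' in
  [|| (l == 0) && (l' == 0), (l < 7) && (l' == l.+1) | (l' < 7) && (l == l'.+1)].
Proof.
move=> j7; rewrite !inE.
by do 7![case: j j7 => [|j] j7; first by move=> /orP[]/eqP-> /orP[]/eqP->].
Qed.

(** This is what makes stages j and j + 1 contiguous: a simplex and its two images
    span simplices of the prism. *)
Lemma stage_compat d j i i' p q :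
    j < 7 -> i \in [:: j; j.+1] -> i' \in [:: j; j.+1] ->
  compat p q -> compat (stage d i p) (stage d i' q).
Proof.
move=> j7.
wlog p2 : p q i i' / p.2 = true => [th ij i'j pq|ij i'j].
  case p2: p.2; first exact: th.
  case q2: q.2; first by rewrite compatC; apply: th; rewrite // compatC.
  by rewrite /compat /= p2 q2.
rewrite /compat /stage /= p2; case: q.2 => //= xy.
case/or3P: (stage_levels j7 ij i'j) => [/andP[/eqP-> /eqP->]|/andP[l7 /eqP->]|/andP[l7 /eqP->]].
- exact: level0_adj.
- exact: level_adj.
by rewrite vec_adjC; apply: level_adj; rewrite // vec_adjC.
Qed.

Lemma stage_below d j p :
  d < m -> j < 8 -> below d p.1 -> below d.+1 (stage d j p).1.
Proof. by move=> dm j8; apply: level_below; rewrite // stage_level_lt. Qed.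

Lemma simplex_prism d e j s : d < m -> j < 7 -> simplex d e s ->
  all (simplex d.+1 e.+1) (prism (stage d j) (stage d j.+1) s).
Proof.
move=> dm j7 /and3P[/eqP sz /allP s_below /allrelP s_compat].
have imP p : p \in map (stage d j) s ++ map (stage d j.+1) s ->
    exists i q, [/\ i \in [:: j; j.+1], q \in s & p = stage d i q].
  rewrite mem_cat => /orP[]/mapP[q qs ->]; [exists j, q|exists j.+1, q];
    by rewrite !inE eqxx ?orbT.
apply/allP => u /mem_prism[szu sub]; apply/and3P; split; first by rewrite szu sz.
  apply/allP => p /sub/imP[i [q [ij qs ->]]]; apply: stage_below => //; last exact: s_below.
  by move: ij; rewrite !inE => /orP[]/eqP->; lia.
apply/allrelP => p p' /sub/imP[i [q [ij qs ->]]] /sub/imP[i' [q' [i'j q's ->]]].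
by apply: stage_compat ij i'j _ => //; exact: s_compat.
Qed.

(** At stage 7 the positive vertices all equal the positive apex, which is
    compatible with every negative vertex there. *)
Lemma simplex_cone d e x0 s : d < m -> below d x0 -> simplex d e s ->
  simplex d.+1 e.+1 ((level d 7 x0, true) :: map (stage d 7) s).
Proof.
move=> dm x0d /and3P[/eqP sz /allP s_below /allrelP s_compat].
have apexP q : compat (level d 7 x0, true) (stage d 7 q).
  by rewrite /compat /=; case: q.2 => //=; exact: apex_adj.
apply/and3P; split; first by rewrite /= size_map sz.
  rewrite /= level_below //=; apply/allP => _ /mapP[q qs ->].
  by apply: stage_below => //; exact: s_below.
apply/allrelP => p p'; rewrite !inE => /predU1P[->|/mapP[q qs ->]] /predU1P[->|/mapP[q' q's ->]] //.
  by rewrite compatC.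
by apply: (@stage_compat d 6) => //; exact: s_compat.
Qed.

Lemma simplex_flip d e s : simplex d e s -> simplex d e (map (@flip _) s).
Proof.
case/and3P=> sz s_below /allrelP s_compat; apply/and3P; split.
- by rewrite size_map.
- by rewrite all_map.
apply/allrelP => _ _ /mapP[p ps ->] /mapP[q qs ->].
by have := s_compat p q ps qs; rewrite /compat /= (inj_eq negb_inj).
Qed.

(** * Filling cycles *)

Definition filling d e (z w : seq (seq (vec * bool))) :=
  all (simplex d e) w /\ forall F, pairing (cobdry F) w = pairing F z.

(** The sum of the prisms over z between consecutive stages; stage 0 is the
    identity on the vertices of z. *)
Lemma stage_homotopy d e z J : d < m -> J <= 7 -> all (simplex d e) z ->
    (forall F, pairing (cobdry F) z = false) ->
  exists w, all (simplex d.+1 e.+1) w /\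
    forall F, pairing (cobdry F) w =
      pairing F z (+) pairing (F \o map (stage d J)) z.
Proof.
move=> dm J7 /allP simp_z cyc_z; elim: J J7 => [|J IHJ] J7.
  exists [::]; split=> // F; rewrite {1}/pairing big_nil; apply/esym.
  rewrite /pairing (eq_big_seq (F \o map (stage d 0))) ?addbb //= => s /simp_z/and3P[_ /allP s_below _].
  congr F; rewrite -[LHS]map_id; apply/eq_in_map => p /s_below p_below.
  by rewrite /stage /stage_level if_same level0 //; case: (p).
have [w [simp_w w_bdry]] := IHJ (ltnW J7).
exists (w ++ flatten (map (prism (stage d J) (stage d J.+1)) z)); split=> [|F].
  rewrite all_cat simp_w; apply/allP => u /flatten_mapP[s /simp_z simp_s].
  by move: u; apply/allP; exact: simplex_prism.
rewrite pairing_cat w_bdry pairing_flatten.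
have -> : pairing (fun s => pairing (cobdry F) (prism (stage d J) (stage d J.+1) s)) z
   = pairing (fun s => cobdry (fun t => pairing F (prism (stage d J) (stage d J.+1) t)) s
      (+) (F (map (stage d J) s) (+) F (map (stage d J.+1) s))) z.
  by apply: eq_bigr => s _; exact: prism_cobdry.
rewrite pairing_addb cyc_z pairing_addb /=.
by rewrite -addbA addKb.
Qed.

(** The homotopy carries z to stage 7, and the cone from the apex fills the
    result.  The apex is the common image of all vertices at level 7. *)
Lemma cycle_filling d e z x0 : d < m -> below d x0 -> all (simplex d e) z ->
    (forall F, pairing (cobdry F) z = false) ->
  exists w, filling d.+1 e.+1 z w.
Proof.
move=> dm x0d simp_z cyc_z.
have [w [simp_w w_bdry]] := stage_homotopy dm (leqnn 7) simp_z cyc_z.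
pose a := (level d 7 x0, true).
exists (w ++ map (cons a \o map (stage d 7)) z); split=> [|F].
  rewrite all_cat simp_w all_map; apply: sub_all simp_z => s; exact: simplex_cone.
rewrite pairing_cat w_bdry pairing_map -addbA -pairing_addb.
have -> : pairing (fun s => (F \o map (stage d 7)) s (+)
     (cobdry F \o (cons a \o map (stage d 7))) s) z =
   pairing (cobdry (F \o cons a \o map (stage d 7))) z.
  by apply: eq_bigr => s _; rewrite /= cobdry_cons cobdry_map addKb.
by rewrite cyc_z addbF.
Qed.

(** * Cycles with an odd number of alternating simplices *)

Section Coloring.
Variables (c : nat) (color : vec -> nat).
Hypothesis color_lt : forall x, color x < c.
Hypothesis color_proper : forall x y, omega5_vertex x -> omega5_vertex y ->
  vec_adj x y -> color x != color y.

Definition fan top s := alternating c top [seq (color p.1, p.2) | p <- s].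

(** In a simplex, vertices of opposite signs are adjacent, so a proper colouring
    gives them different colours. *)
Lemma fan_cobdry d e s :
  simplex d e s -> cobdry (fan true) s = fan true s (+) fan true (map (@flip _) s).
Proof.
case/and3P=> _ /allP s_below /allrelP s_compat.
rewrite /fan -(cobdry_map _ (alternating c true)) alternating_cobdry.
- congr (_ (+) _); rewrite -[false]/(~~ true) -alternating_flip -!map_comp.
  exact: congr1.
- by rewrite all_map; apply/allP => p _ /=.
move=> _ _ /mapP[p ps ->] /mapP[q qs ->] /= eq_col.
have /orP[/eqP//|pq] := s_compat p q ps qs.
have /andP[pv _] := s_below p ps; have /andP[qv _] := s_below q qs.
by have := color_proper pv qv pq; rewrite eq_col eqxx.
Qed.

(** Simplices with e vertices, so the dimension is e - 1. *)
Definition fan_cycle d e z :=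
  [/\ all (simplex d e) z,
      forall F, pairing (cobdry F) z = false,
      forall F, pairing (F \o map (@flip _)) z = pairing F z
    & pairing (fan true) z = true].

(** The sum of w and its image under the sign change is a cycle because z is
    invariant; its number of positive alternating simplices is the number of
    alternating simplices of w of both kinds, hence that of the positive ones
    of z. *)
Lemma fan_cycle_suspension d d' e z w :
  fan_cycle d e z -> filling d' e.+1 z w ->
  fan_cycle d' e.+1 (w ++ map (map (@flip _)) w).
Proof.
move=> [_ _ sym_z odd_z] [simp_w w_bdry]; split.
- rewrite all_cat simp_w all_map; apply: sub_all simp_w => s; exact: simplex_flip.
- move=> F; rewrite pairing_cat pairing_map w_bdry -sym_z -w_bdry -pairing_addb.
  by rewrite /pairing big1 // => s _; rewrite /= cobdry_map addbb.
- move=> F; rewrite !pairing_cat !pairing_map addbC; congr (_ (+) _).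
  apply: eq_bigr => s _ /=; rewrite -map_comp map_id_in // => p _.
  by rewrite /flip /= negbK; case: p.
rewrite pairing_cat pairing_map -pairing_addb -[RHS]odd_z -w_bdry.
by apply: eq_big_seq => s /(allP simp_w)/fan_cobdry->.
Qed.

(** The vertices x = (0, 1, 3, ...) and y = (1, 0, 3, ...) span a copy of K_2.  The
    4-cycle +x, +y, -x, -y arises by suspending the empty simplex twice. *)
Lemma fan_cycle_base : 1 < m ->
  exists x0, below 2 x0 /\ exists z, fan_cycle 2 2 z.
Proof.
move=> m1; have m0 := ltnW m1.
pose pt (b : bool) : vec := [ffun i : 'I_m => inord (nth 3 [:: b : nat; ~~ b : nat] i)].
have ptE b i : pt b i = nth 3 [:: b : nat; ~~ b : nat] i :> nat.
  by rewrite ffunE inordK //; case: i b => -[|[|i]] ? [] //=; rewrite nth_nil.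
have pt_below b : below 2 (pt b).
  apply/andP; split; last first.
    by apply/forallP => i; rewrite ptE; case: i => -[|[|i]] ? //=; rewrite nth_nil.
  apply/andP; split; last first.
    by apply/existsP; exists (if b then Ordinal m0 else Ordinal m1); rewrite ptE; case: b.
  apply/cards1P; exists (if b then Ordinal m1 else Ordinal m0); apply/setP => i.
  rewrite !inE ptE -val_eqE.
  by case: b; case: i => -[|[|i]] ? //=; rewrite nth_nil.
have pt_adj b : vec_adj (pt b) (pt (~~ b)).
  by apply/forallP => i; rewrite !ptE; case: b; case: i => -[|[|i]] ? //=; rewrite !nth_nil.
have [x_below y_below] := (pt_below false, pt_below true).
have [xy yx] := (pt_adj false, pt_adj true).
set x := pt false in x_below xy; set y := pt true in y_below yx.
exists x; split=> //.
have cyc0 : fan_cycle 2 0 [:: [::]].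
  split=> // [F|F|].
  - by rewrite /pairing big_seq1 /cobdry /pairing big_nil.
  - by rewrite /pairing !big_seq1.
  by rewrite /pairing big_seq1 /fan alternating_nil.
have fill1 : filling 2 1 [:: [::]] [:: [:: (x, true)]].
  split=> [|F]; first by rewrite /= /simplex /= x_below /allrel /= /compat.
  by rewrite /cobdry /pairing !big_seq1 /=.
have /fan_cycle_suspension := fan_cycle_suspension cyc0 fill1.
move=> /(_ 2 [:: [:: (x, true); (y, true)]; [:: (y, true); (x, false)]]) th.
eexists; apply: th; split=> [|F].
  by rewrite /= /simplex /= x_below y_below /allrel /= /compat /= xy yx.
rewrite /cobdry /pairing /= !(big_cons, big_nil) !addbF /=.
by move: (F _) (F _) (F _); do 3!case.
Qed.

(** An alternating simplex with m vertices has m different colours. *)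
Lemma fan_cycle_dim : 1 < m -> m <= c.
Proof.
move=> m1; have [x0 [x0_below [z2 cyc2]]] := fan_cycle_base m1.
have below_x0 d : 2 <= d -> below d x0.
  move=> d2; case/andP: x0_below => x0v /forallP x03; apply/andP; split=> //.
  by apply/forallP => i; apply/implyP => di; apply: (implyP (x03 i)); exact: leq_trans di.
have grow k : k.+2 <= m -> exists z, fan_cycle k.+2 k.+2 z.
  elim: k => [|k IHk] km; first by exists z2.
  have [z cyc_z] := IHk (ltnW km); have [simp_z bdry_z _ _] := cyc_z.
  have [w fill_w] := cycle_filling km (below_x0 k.+2 isT) simp_z bdry_z.
  by eexists; exact: fan_cycle_suspension cyc_z fill_w.
have [z [simp_z _ _ odd_z]] := grow m.-2 ltac:(lia).
have m2 : m.-2.+2 = m by lia.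
rewrite {}m2 in simp_z.
rewrite leqNgt; apply/negP => cm; move: odd_z.
rewrite /pairing big_seq big1 // => s /(allP simp_z)/and3P[/eqP sz _ _].
apply/negP => /alternating_size; rewrite size_map sz; lia.
Qed.

End Coloring.

End Levels.

Lemma omega5_not_colorable m c :
  0 < c -> c < m -> ~~ colorable (omega5K m) c.
Proof.
move=> c_gt0 cm; have m1 := leq_ltn_trans c_gt0 cm; apply/negP => /existsP[f /forallP colf].
(* The colouring, extended to all tuples by an arbitrary value. *)
pose color (x : {ffun 'I_m -> 'I_4}) : nat :=
  if insub x is Some v then f v else Ordinal c_gt0.
suff: m <= c by rewrite leqNgt cm.
apply: (@fan_cycle_dim m c color) => // [x|x y xv yv xy]; first by rewrite /color; case: insub => [v|] /=.
rewrite /color !insubT /=.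
by have /forallP/(_ (exist _ y yv))/implyP := colf (exist _ x xv); apply.
Qed.

(** * The counterexample *)

Unset Implicit Arguments.

Theorem mainTheorem3 (k c n : nat)
    (k_gt0 : 0 < k) (c_gt0 : 0 < c) (n_gt0 : 0 < n)
    (hc : n + k + 1 <= c) (hn : k + 1 <= n) (hnk : c + 1 <= n * k) :
  let G := omega5K (c + 1) in
  let H := exp_graph c G in
  [/\ natinf_lt (Some c) (chi G),
      natinf_lt (Some c) (chi H)
    & natinf_le (chi (tensor G H)) (Some c)].
Proof.
move=> G H; split.
- by apply/chi_gt/omega5_not_colorable; rewrite // addn1.
- by apply/chi_gt/(exp_omega5_not_colorable k_gt0 _ hc hnk); lia.
- exact/chi_le/tensor_exp_colorable.
Qed.
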